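(* There is a function $g\colon\mathbb{N}\to\mathbb{N}$ with $g(k)=O(k^{3/2})$ such that the following holds: if $\pi$ is a $321$-avoiding permutation such that the graph $G_\pi$ contains a $g(k)$-wall, then $\pi$ contains the $k$-track.
   Context: For a permutation $\pi=\pi(1),\dots,\pi(k)$, the graph $G_\pi$ has vertex set $\{1,\dots,k\}$ (the values of $\pi$), and $\pi(i),\pi(j)$ are adjacent iff $|i-j|=1$ or $|\pi(i)-\pi(j)|=1$. For even $r\ge2$, the elementary wall of height $r$ is obtained from the $(r+1)\times(2r+2)$ grid (vertex set $[r+1]\times[2r+2]$, with $(i,j),(i',j')$ adjacent iff $|i-i'|+|j-j'|=1$) by removing the two corners $(1,2r+2)$ and $(r+1,1)$, the edges $\{(i,2j),(i+1,2j)\}$ for $i$ odd and $1\le j\le r+1$, and the edges $\{(i,2j-1),(i+1,2j-1)\}$ for $i$ even and $1\le j\le r+1$. An $r$-wall is a subdivision of the elementary wall of height $r$; a graph contains an $r$-wall if it has a subgraph that is an $r$-wall. A permutation $\tau$ contains $\pi$ if $\tau$ has a subsequence whose entries are in the same relative order as the entries of $\pi$. The reduction of a sequence of distinct positive integers replaces its $i$th smallest entry by $i$. The $k$-track is the permutation of size $k^2$ that is the reduction of $(1,2k,3,2k+2,5,2k+4,\dots,k^2-1,k^2+2k-2)$ if $k$ is even, and of $(1,2k,3,2k+2,5,2k+4,\dots,k^2-k-1,k^2+k-2,k^2-k+1,k^2-k+3,\dots,k^2+k-1)$ if $k$ is odd. *)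

(* Defs.v *)
From mathcomp Require Import all_boot all_fingroup.
From mathcomp Require Import zify.
Set Implicit Arguments.
Unset Strict Implicit.
Unset Printing Implicit Defensive.

Record graph := Graph {
  vertex :> finType;
  adj : rel vertex;
  adj_sym : symmetric adj;
  adj_irr : irreflexive adj }.

Arguments adj : clear implicits.

(* [phi] gives the branch vertices and [P u v] lists the inner vertices, from *)
(* [phi u] to [phi v], of the path that replaces the edge [uv]. *)
Definition is_subdivision (H W : graph) : Prop :=
  exists (phi : H -> W) (P : H -> H -> seq W),
    [/\ injective phi,
        forall u v, adj H u v ->
          [/\ uniq (P u v), P v u = rev (P u v)
            & forall w : H, phi w \notin P u v],
        forall u v u' v', adj H u v -> adj H u' v' ->
          (exists2 x, x \in P u v & x \in P u' v') ->
          (u', v') = (u, v) \/ (u', v') = (v, u),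
        forall x : W, (exists u, x = phi u) \/
          (exists u v, adj H u v /\ x \in P u v)
      & forall x y : W, adj W x y <->
          (exists u v, adj H u v /\
             infix [:: x; y] (phi u :: rcons (P u v) (phi v)))].

Definition subgraph (W G : graph) : Prop :=
  exists f : W -> G,
    injective f /\ (forall x y, adj W x y -> adj G (f x) (f y)).

Definition consec (m n : nat) : bool := (m == n.+1) || (n == m.+1).

Lemma consecC : commutative consec.
Proof. by move=> m n; rewrite /consec orbC. Qed.

Lemma consec_irr : irreflexive consec.
Proof. by move=> n; rewrite /consec -[X in X == _]addn0 -addn1 eqn_add2l. Qed.

Section Wall.
Variable r : nat.

(* The vertex [(i, j)] of the grid is the pair of ordinals [(i - 1, j - 1)]; *)
(* [wrow] and [wcol] recover the coordinates counted from 1. *)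
Definition grid : finType := ('I_r.+1 * 'I_(2 * r + 2))%type.
Definition wrow (x : grid) : nat := x.1.+1.
Definition wcol (x : grid) : nat := x.2.+1.

Definition is_corner (x : grid) : bool :=
  ((wrow x == 1) && (wcol x == 2 * r + 2)) ||
  ((wrow x == r.+1) && (wcol x == 1)).

(* The edge between [(i, j)] and [(i + 1, j)] is deleted. *)
Definition rung_removed (i j : nat) : bool :=
  (odd i && ~~ odd j) || (~~ odd i && odd j).

Definition wall_vertex : finType := {x : grid | ~~ is_corner x}.

Definition wall_adj (x y : wall_vertex) : bool :=
  let a := val x in let b := val y in
  ((wrow a == wrow b) && consec (wcol a) (wcol b)) ||
  [&& wcol a == wcol b, consec (wrow a) (wrow b)
    & ~~ rung_removed (minn (wrow a) (wrow b)) (wcol a)].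

Lemma wall_adj_sym : symmetric wall_adj.
Proof.
move=> x y; rewrite /wall_adj minnC [consec (wcol (val x)) _]consecC.
rewrite [consec (wrow (val x)) _]consecC [wrow (val x) == _]eq_sym.
rewrite [wcol (val x) == _]eq_sym.
by case: (wcol (val y) =P wcol (val x)) => [->|].
Qed.

Lemma wall_adj_irr : irreflexive wall_adj.
Proof. by move=> x; rewrite /wall_adj !consec_irr !andbF. Qed.

Definition elementary_wall : graph := Graph wall_adj_sym wall_adj_irr.
End Wall.

(* Meaningful for even [r >= 2] only. *)
Definition is_wall (r : nat) (W : graph) : Prop :=
  is_subdivision (elementary_wall r) W.

Definition contains_wall (r : nat) (G : graph) : Prop :=
  exists2 W : graph, is_wall r W & subgraph W G.

Section PermGraph.
Variables (n : nat) (p : 'S_n).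

(* The vertices are the values of [p]; [p^-1 u] is the position of [u]. *)
Definition perm_adj (u v : 'I_n) : bool :=
  consec ((p^-1)%g u) ((p^-1)%g v) || consec u v.

Lemma perm_adj_sym : symmetric perm_adj.
Proof. by move=> u v; rewrite /perm_adj consecC [consec u v]consecC. Qed.

Lemma perm_adj_irr : irreflexive perm_adj.
Proof. by move=> u; rewrite /perm_adj !consec_irr. Qed.

Definition perm_graph : graph := Graph perm_adj_sym perm_adj_irr.
End PermGraph.

Definition contains (n m : nat) (t : 'S_n) (p : 'S_m) : Prop :=
  exists f : 'I_m -> 'I_n,
    (forall i j : 'I_m, i < j -> f i < f j) /\
    (forall i j : 'I_m, (t (f i) < t (f j)) = (p i < p j)).

Definition perm321 : 'S_3 := perm (@rev_ord_inj 3).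

Definition avoids321 (n : nat) (p : 'S_n) : Prop := ~ contains p perm321.

Section Reduction.
Variables (n : nat) (f : 'I_n -> nat).

Lemma red_subproof (i : 'I_n) : #|[set j | f j < f i]| < n.
Proof.
rewrite -[X in _ < X]card_ord -cardsT; apply: proper_card.
by apply/properP; split; [exact: subsetT | exists i; rewrite !inE // ltnn].
Qed.

(* Values are counted from 0, as everywhere in ['S_n]. *)
Definition red (i : 'I_n) : 'I_n := Ordinal (red_subproof i).

Lemma red_inj : injective f -> injective red.
Proof.
move=> f_inj.
have lt_red i j : f i < f j -> red i < red j.
  move=> ltij; apply: proper_card; apply/properP; split.
    by apply/subsetP => k; rewrite !inE => /ltn_trans; apply.
  by exists i; rewrite !inE ?ltnn.
move=> i j eq_ij; apply: f_inj.
by case: (ltngtP (f i) (f j)) => // /lt_red; rewrite eq_ij ltnn.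
Qed.

Definition reduction (f_inj : injective f) : 'S_n := perm (red_inj f_inj).
End Reduction.

(* The entry in position [i], counted from 0, of the sequence *)
(* 1, 2k, 3, 2k+2, 5, 2k+4, ..., whose last [k] entries are *)
(* k^2-k+1, k^2-k+3, ..., k^2+k-1 when [k] is odd. *)
Definition track_entry (k : nat) (i : 'I_(k ^ 2)) : nat :=
  if odd k && (k ^ 2 - k <= i) then k ^ 2 - k + 1 + 2 * (i - (k ^ 2 - k))
  else if odd i then 2 * k + i.-1 else i.+1.

Lemma track_entry_inj (k : nat) : injective (@track_entry k).
Proof.
have even_kk : odd (k ^ 2 - k) = false.
  rewrite -mulnn -[X in _ - X]muln1 -mulnBr oddM.
  by case: k => // k; rewrite subn1 /=; case: odd.
move=> i j; rewrite /track_entry => eq_ij; apply: val_inj => /=.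
move: (k ^ 2 - k) even_kk (nat_of_ord i) (nat_of_ord j) eq_ij => m even_m a b.
case: (odd k) => /=; last by case: ifP; case: ifP; lia.
by do 2 case: ifP => ?; repeat case: ifP => ?; lia.
Qed.

Definition track (k : nat) : 'S_(k ^ 2) := reduction (@track_entry_inj k).

(* Main.v *)
Require Import Defs.
From mathcomp Require Import all_boot all_fingroup zify boolp.
Set Implicit Arguments.
Unset Strict Implicit.
Unset Printing Implicit Defensive.

(** A 321-avoiding permutation fits into an infinite staircase of
increasing cells ("columns"), in which two consecutive columns share a
horizontal or a vertical strip.  Apart from the edges that jump from the end
of a strip to the start of a later one, the graph of the permutation is then
drawn in the plane, with the columns as vertical lines.

In a window of [k] columns, climb from the bottom by steps between adjacent
columns, each step going to the next point of the new column.  If no climb of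
fewer than [3 * k] steps leaves the window through the top, the heights that
are reached form [k] interleaved threads across the window, which is a
[k]-track.  Otherwise, a short climb is a curve that meets [O(k)] vertices and
separates the columns to the left of the window from those to its right.
Between two successive such curves there are only [O(k)] columns, and they can
be swept from bottom to top.  So if there is no [k]-track, the vertices can be
added one at a time so that the edges leaving the current set always have a
vertex cover of size [O(k)].  In a wall this fails at the moment when the first
row or column is swallowed.  This gives the linear bound [g k = 16 * k + 8]. *)

(** * Disjoint connected families and covers of a boundary *)

Section Brambles.

Variables (V : finType) (e : rel V).

Definition covers_boundary (A N : {set V}) :=
  forall u v, e u v -> u \in A -> v \notin A -> u \in N \/ v \in N.

(** Connectivity is phrased by cuts instead of paths: each use starts from a set that splits [S] and
    asks for a crossing edge. *)
Definition connected_set (S : {set V}) := forall (A : {set V}) x y,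
  x \in S -> y \in S -> x \in A -> y \notin A ->
  exists u v, [/\ u \in S, v \in S, u \in A, v \notin A & e u v].

Definition disjoint_family m (F : 'I_m -> {set V}) :=
  forall i j x, x \in F i -> x \in F j -> i = j.

Lemma disjoint_family_hit m (F : 'I_m -> {set V}) (J : {set 'I_m}) (N : {set V}) :
  disjoint_family F -> (forall j, j \in J -> exists2 x, x \in F j & x \in N) ->
  #|J| <= #|N|.
Proof.
move=> dF hit; case: (set_0Vmem J) => [->|[j0 /hit[x0 _ _]]]; first by rewrite cards0.
pose f j := odflt x0 [pick x in F j :&: N].
have fP j : j \in J -> f j \in F j :&: N.
  by move=> /hit[x xF xN]; rewrite /f; case: pickP => //= /(_ x); rewrite inE xF xN.
rewrite -(@card_in_imset _ _ f).
  by apply: subset_leq_card; apply/subsetP => _ /imsetP[j /fP + ->]; rewrite inE => /andP[].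
move=> i j /fP + /fP; rewrite !inE => /andP[fi _] /andP[fj _] eq_f.
by apply: dF fi _; rewrite eq_f.
Qed.

(** At most one [F j] contains [v]. Any other one meets [B] and, having a point outside [A], also
    leaves [B]; connectivity gives it an edge across the boundary, hence its own vertex in [N]. *)
Lemma disjoint_family_boundary m (F : 'I_m -> {set V}) (A B N : {set V}) v :
  disjoint_family F -> (forall j, connected_set (F j)) ->
  (forall j, exists2 x, x \in F j & x \in B) ->
  (forall j, ~~ (F j \subset A)) -> B \subset v |: A -> covers_boundary B N ->
  m <= #|N|.+1.
Proof.
move=> dF cF FB FA BA BN.
pose J := [set j | v \notin F j].
have J1 : #|~: J| <= 1.
  apply/card_le1_eqP => i j; rewrite !inE !negbK => vi vj; exact: dF vj vi.
have JN : #|J| <= #|N|.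
  apply: disjoint_family_hit dF _ => j; rewrite inE => vj.
  have [x xF xB] := FB j; have /subsetPn[y yF yA] := FA j.
  have yB : y \notin B.
    apply: contra yA => /(subsetP BA); rewrite !inE => /orP[/eqP yv|//].
    by rewrite -yv yF in vj.
  have [u [w [uF wF uB wB euw]]] := cF j B x y xF yF xB yB.
  by case: (BN u w euw uB wB); [exists u|exists w].
by have := cardsC J; rewrite card_ord; lia.
Qed.

Definition contains_line m (F G : 'I_m -> {set V}) (A : {set V}) :=
  [exists j, F j \subset A] || [exists j, G j \subset A].

(* The moment a growing set first swallows a row or a column of a grid, it
   cuts all but at most one of the lines in the other direction. *)
Lemma grid_boundary m (F G : 'I_m -> {set V}) (A B N : {set V}) v :
  disjoint_family F -> (forall j, connected_set (F j)) ->
  disjoint_family G -> (forall j, connected_set (G j)) ->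
  (forall i j, exists2 x, x \in F i & x \in G j) ->
  ~~ contains_line F G A -> contains_line F G B -> B \subset v |: A ->
  covers_boundary B N -> m <= #|N|.+1.
Proof.
move=> dF cF dG cG FG; rewrite negb_or => /andP[/existsPn AF /existsPn AG].
case/orP=> /existsP[i /subsetP iB] BA BN.
  apply: (disjoint_family_boundary dG cG _ AG BA BN) => j.
  by have [x xF xG] := FG i j; exists x => //; apply: iB.
apply: (disjoint_family_boundary dF cF _ AF BA BN) => j.
by have [x xF xG] := FG j i; exists x => //; apply: iB.
Qed.

End Brambles.

(** * Staircase griddings: columns, strips, local edges and jumps *)

Section Gridding.

Variables (V : finType) (X Y : V -> nat) (col : V -> nat).
Hypotheses (X_inj : injective X) (Y_inj : injective Y).
(** The vertical strips, columns [2m] and [2m+1], succeed one another in [X]; the horizontal strips,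
    columns [2m-1] and [2m], succeed one another in [Y]. *)
Hypothesis colX : forall u v, X u < X v -> (col u)./2 <= (col v)./2.
Hypothesis colY : forall u v, Y u < Y v -> uphalf (col u) <= uphalf (col v).
Hypothesis col_incr : forall u v, col u = col v -> X u < X v -> Y u < Y v.

Definition near u v := (col u <= (col v).+1) && (col v <= (col u).+1).

(** Adjacent columns are compared in the coordinate of the strip they share: horizontal if the left
    column is odd, vertical if it is even. *)
Definition prec u v :=
  near u v && (if odd (minn (col u) (col v)) then Y u < Y v else X u < X v).

Definition key c u := if odd c then Y u else X u.

Lemma col_incrE u v : col u = col v -> (X u < X v) = (Y u < Y v).
Proof.
move=> cuv; case: (ltngtP (X u) (X v)) => [/col_incr-> //|lt|/X_inj->].
  by have := col_incr (esym cuv) lt; lia.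
by rewrite ltnn.
Qed.

Lemma key_inj c : injective (key c).
Proof. by move=> u v; rewrite /key; case: ifP => _; [apply: Y_inj|apply: X_inj]. Qed.

Lemma precE c u v : c <= col u <= c.+1 -> c <= col v <= c.+1 ->
  prec u v = (key c u < key c v).
Proof.
move=> cu cv; rewrite /prec /key.
have -> /= : near u v by rewrite /near; lia.
case: (eqVneq (col u) (col v)) => [e|ne].
  by rewrite (col_incrE e) if_same; case: ifP; rewrite ?(col_incrE e).
have -> : minn (col u) (col v) = c by lia.
by case: ifP.
Qed.

Lemma prec_sameX u v : col u = col v -> prec u v = (X u < X v).
Proof.
move=> e; rewrite (@precE (col u)) ?leqnn ?e ?leqnn ?leqnSn //= /key.
by case: ifP; rewrite ?(col_incrE e).
Qed.

Lemma prec_sameY u v : col u = col v -> prec u v = (Y u < Y v).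
Proof. by move=> e; rewrite prec_sameX // col_incrE. Qed.

Lemma nearC u v : near u v = near v u.
Proof. by rewrite /near andbC. Qed.

Lemma near_strip u v : near u v ->
  exists2 c, c <= col u <= c.+1 & c <= col v <= c.+1.
Proof. by rewrite /near => nuv; exists (minn (col u) (col v)); lia. Qed.

Lemma near_col u v c d : col u = c -> col v = d ->
  c = d \/ d = c.+1 \/ d.+1 = c -> near u v.
Proof. by rewrite /near => -> ->; lia. Qed.

Lemma near_cases u v c d : near u v -> col v = d -> d = c.+1 \/ d.+1 = c ->
  col u = d \/ col u = c \/ col u + c = d + d.
Proof. by rewrite /near => nuv cv hd; lia. Qed.

Lemma prec_near u v : prec u v -> near u v.
Proof. by case/andP. Qed.

Lemma prec_total u v : near u v -> u = v \/ (prec u v \/ prec v u).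
Proof.
case/near_strip=> c cu cv; rewrite !(@precE c) //.
by case: (ltngtP (key c u) (key c v)) => [|| /key_inj ->]; auto.
Qed.

Lemma prec_asym u v : prec u v -> prec v u -> False.
Proof.
move=> /[dup] /prec_near /near_strip [c cu cv].
by rewrite !(@precE c) //; lia.
Qed.

Lemma near3 u v w : near u v -> near v w -> near u w ->
  exists c, [/\ c <= col u <= c.+1, c <= col v <= c.+1 & c <= col w <= c.+1].
Proof.
rewrite /near => *; exists (minn (col u) (minn (col v) (col w))); split; lia.
Qed.

(** Three pairwise near vertices lie in two adjacent columns, where [prec] is the linear order given
    by [key]. Without [near u w] the conclusion can fail. *)
Lemma prec_trans v u w : near u w -> prec u v -> prec v w -> prec u w.
Proof.
move=> nuw puv pvw.
have [c [cu cv cw]] := near3 (prec_near puv) (prec_near pvw) nuw.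
by move: puv pvw; rewrite !(@precE c) //; apply: ltn_trans.
Qed.

Definition grid_adj u v := consec (X u) (X v) || consec (Y u) (Y v).

(* [local_edge] collects the edges inside a strip.  The remaining edges,
   [jump_edge], lead from the end of a strip to the start of a later one. *)
Definition local_edge u v := near u v /\
  forall w, col w = col u \/ col w = col v ->
    ~ (prec u w /\ prec w v) /\ ~ (prec v w /\ prec w u).

Definition jump_edge u v :=
  (X v = (X u).+1 /\ (col u)./2 < (col v)./2) \/
  (Y v = (Y u).+1 /\ uphalf (col u) < uphalf (col v)).

Lemma local_edgeC u v : local_edge u v -> local_edge v u.
Proof.
case=> nuv h; split; first by rewrite nearC.
by move=> w cw; case: (h w) => [|h1 h2]; [case: cw; auto | split].
Qed.

Lemma local_strip c u v : c <= col u <= c.+1 -> c <= col v <= c.+1 ->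
  key c v = (key c u).+1 -> local_edge u v.
Proof.
move=> cu cv e; split; first by rewrite /near; lia.
move=> w cw.
have cw' : c <= col w <= c.+1 by case: cw => ->.
by rewrite !(@precE c) //; lia.
Qed.

Lemma edge_succX u v : X v = (X u).+1 -> local_edge u v \/ jump_edge u v.
Proof.
move=> e; have le : (col u)./2 <= (col v)./2 by apply: colX; lia.
case: (ltnP (col u)./2 (col v)./2) => lt; first by right; left.
left; apply: (@local_strip (col u)./2.*2); try lia.
by rewrite /key odd_double.
Qed.

Lemma edge_succY u v : Y v = (Y u).+1 -> local_edge u v \/ jump_edge u v.
Proof.
move=> e; have le : uphalf (col u) <= uphalf (col v) by apply: colY; lia.
case: (ltnP (uphalf (col u)) (uphalf (col v))) => lt; first by right; right.
(* Column 0 has no left neighbour and forms a horizontal strip alone. *)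
left; case: (posnP (uphalf (col u))) => [z|pos].
  have cu : col u = 0 by lia.
  have cv : col v = 0 by lia.
  split; first by rewrite /near cu cv.
  move=> w; rewrite cu cv => cw.
  by rewrite !prec_sameY //; lia.
apply: (@local_strip (uphalf (col u)).-1.*2.+1); try lia.
by rewrite /key /= odd_double.
Qed.

Lemma edge_cases u v : grid_adj u v ->
  local_edge u v \/ (jump_edge u v \/ jump_edge v u).
Proof.
rewrite /grid_adj /consec => /orP[] /orP[] /eqP e.
- by case: (edge_succX e) => [/local_edgeC|]; auto.
- by case: (edge_succX e); auto.
- by case: (edge_succY e) => [/local_edgeC|]; auto.
- by case: (edge_succY e); auto.
Qed.

Definition column_first u := [forall w, (col w == col u) ==> (X u <= X w)].
Definition column_last u := [forall w, (col w == col u) ==> (X w <= X u)].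

Lemma jump_col u v : jump_edge u v -> col u < col v.
Proof. by case=> -[_]; lia. Qed.

(** A vertex of the column of [v] before [v] would be at or before [u] in the coordinate of the
    jump, yet it lies in a later strip than [u]. *)
Lemma jump_first u v : jump_edge u v -> column_first v.
Proof.
move=> jv; apply/forallP => w; apply/implyP => /eqP cw.
rewrite leqNgt; apply/negP => lt.
have lty := lt; rewrite (col_incrE cw) in lty.
case: jv => -[e lc].
  have [xuw|/X_inj uw] : X w < X u \/ X w = X u by lia.
    by have := colX xuw; rewrite cw; lia.
  by rewrite -uw cw ltnn in lc.
have [xuw|/Y_inj uw] : Y w < Y u \/ Y w = Y u by lia.
  by have := colY xuw; rewrite cw; lia.
by rewrite -uw cw ltnn in lc.
Qed.

Lemma jump_last u v : jump_edge u v -> column_last u.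
Proof.
move=> jv; apply/forallP => w; apply/implyP => /eqP cw.
rewrite leqNgt; apply/negP => lt.
have lty := lt; rewrite (col_incrE (esym cw)) in lty.
case: jv => -[e lc].
  have [xuw|/X_inj uw] : X v < X w \/ X v = X w by lia.
    by have := colX xuw; rewrite cw; lia.
  by rewrite uw cw ltnn in lc.
have [xuw|/Y_inj uw] : Y v < Y w \/ Y v = Y w by lia.
  by have := colY xuw; rewrite cw; lia.
by rewrite uw cw ltnn in lc.
Qed.

Definition lastX a u := (col u < a) && [forall w, (col w < a) ==> (X w <= X u)].
Definition lastY a u := (col u < a) && [forall w, (col w < a) ==> (Y w <= Y u)].

(** As [a] is even, [v] lies in a strictly later strip than every column before [a], vertically or
    horizontally according to the jump. So no vertex of these columns comes after [u] in that
    coordinate, and at most two vertices can start such a jump. *)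
Lemma jump_over a u v : ~~ odd a -> jump_edge u v -> col u < a -> a < col v ->
  lastX a u || lastY a u.
Proof.
move=> ea juv cu cv; rewrite /lastX /lastY cu /=; apply/orP.
case: juv => -[e lc]; [left|right]; apply/forallP => w; apply/implyP => cw;
    rewrite leqNgt; apply/negP => lt.
  have [xuw|/X_inj uw] : X v < X w \/ X v = X w by lia.
    by have := colX xuw; lia.
  by rewrite uw in cv; lia.
have [xuw|/Y_inj uw] : Y v < Y w \/ Y v = Y w by lia.
  by have := colY xuw; lia.
by rewrite uw in cv; lia.
Qed.

Lemma card_per_column (A : {set V}) a m :
  (forall u, u \in A -> a <= col u < a + m) ->
  (forall u v, u \in A -> v \in A -> col u = col v -> u = v) -> #|A| <= m.
Proof.
move=> hA iA.
case: m hA => [|m] hA.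
  rewrite leqn0 cards_eq0 -subset0; apply/subsetP => u /hA; lia.
rewrite -[m.+1]card_ord.
rewrite -(@card_in_imset _ _ (fun u => inord (col u - a) : 'I_m.+1)) ?max_card //.
move=> u v uA vA /(congr1 val) /=.
have au := hA _ uA; have av := hA _ vA.
by rewrite !inordK; try lia; move=> e; apply: iA => //; lia.
Qed.

Lemma card_setU_le (A B : {set V}) : #|A :|: B| <= #|A| + #|B|.
Proof. by rewrite leq_card_setU. Qed.

Lemma card_le1 (A : {set V}) :
  (forall u v, u \in A -> v \in A -> u = v) -> #|A| <= 1.
Proof. by move=> h; apply/card_le1_eqP => u v uA vA; apply: h. Qed.

Lemma prec_min (A : {set V}) : (exists u, u \in A) -> exists2 v, v \in A &
  forall u, u \in A -> ~ prec u v.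
Proof.
case=> u0 u0A.
(* The least vertex of [A] in a column that lies below all of [A] in the
   preceding column; the rightmost such column works. *)
pose good c := [exists u in A, (col u == c) &&
  [forall w in A, ((col w == c) ==> (X u <= X w)) &&
                  (((col w).+1 == c) ==> prec u w)]].
have ex0 : exists c, good c.
  pose u1 := [arg min_(u < u0 in A) col u].
  have [u1A minu1] : u1 \in A /\ forall w, w \in A -> col u1 <= col w.
    by rewrite /u1; case: arg_minnP => // i iA hi; split=> // w; apply: hi.
  pose u2 := [arg min_(u < u1 | (u \in A) && (col u == col u1)) X u].
  have [/andP[u2A /eqP c2] minu2] : (u2 \in A) && (col u2 == col u1) /\
      forall w, (w \in A) && (col w == col u1) -> X u2 <= X w.
    by rewrite /u2; case: arg_minnP => [|i iA hi]; rewrite ?u1A /= ?eqxx.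
  exists (col u1); apply/existsP; exists u2; rewrite u2A c2 eqxx /=.
  apply/forallP => w; apply/implyP => wA; apply/andP; split; apply/implyP.
    by move=> cw; apply: minu2; rewrite wA.
  by move/eqP=> cw; have := minu1 _ wA; lia.
have bound c : good c -> c <= \max_(u : V) col u.
  case/existsP=> u /and3P[_ /eqP<- _]; exact: (leq_bigmax (F := col)).
case: (ex_maxnP ex0 bound) => c /existsP[v /and3P[vA /eqP cv /forallP hv]] maxc.
exists v => // u uA puv.
have nuv := prec_near puv; rewrite /near in nuv.
have [c1|[c1|c1]] : col u = c \/ (col u).+1 = c \/ col u = c.+1 by lia.
- have := hv u; rewrite uA c1 eqxx /= => /andP[le _].
  by move: puv; rewrite prec_sameX ?c1 ?cv //; lia.
- have := hv u; rewrite uA c1 eqxx /= => /andP[_ pvu]; exact: prec_asym pvu.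
(* A predecessor in column [c.+1] would make that column good too, against the choice of [c]. *)
pose u2 := [arg min_(w < u | (w \in A) && (col w == c.+1)) X w].
have [/andP[u2A /eqP c2] minu2] : (u2 \in A) && (col u2 == c.+1) /\
    forall w, (w \in A) && (col w == c.+1) -> X u2 <= X w.
  by rewrite /u2; case: arg_minnP => [|i iA hi]; rewrite ?uA /= ?c1 ?eqxx.
have p2u : u2 = u \/ prec u2 u.
  rewrite prec_sameX ?c1 //; have := minu2 u; rewrite uA c1 eqxx => /(_ isT).
  by rewrite leq_eqVlt => /orP[/eqP/X_inj|]; auto.
have p2v : prec u2 v.
  case: p2u => [->//|p2u]; apply: prec_trans p2u puv; rewrite /near; lia.
suff /maxc : good c.+1 by lia.
apply/existsP; exists u2; rewrite u2A c2 eqxx /=.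
apply/forallP => w; apply/implyP => wA; apply/andP; split; apply/implyP.
  by move=> cw; apply: minu2; rewrite wA.
rewrite eqSS => /eqP cw; have := hv w; rewrite wA cw eqxx /= => /andP[le _].
have [<-//|lt] : v = w \/ X v < X w.
  by move: le; rewrite leq_eqVlt => /orP[/eqP/X_inj|]; auto.
rewrite -prec_sameX ?cw ?cv // in lt.
apply: prec_trans p2v lt; rewrite /near; lia.
Qed.

(** * Climbs in a window and the curves obtained from them *)

Section Window.

Variables (a k : nat).

Definition in_window c := a <= c < a + k.

(* [climb T] consists of the vertices that cannot be reached from the bottom
   of the window by fewer than [T] steps between adjacent columns, each step
   going to the next vertex of the new column. *)
Fixpoint climb T : {set V} :=
  if T is T'.+1 then
    [set u | in_window (col u) ==>
       [forall c : bool, let d := if c then (col u).+1 else (col u).-1 in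
          (in_window d && (d != col u)) ==>
          [exists v in climb T', (col v == d) && prec v u]]]
  else [set: V].

Lemma climbSP T u d : u \in climb T.+1 -> in_window (col u) -> in_window d ->
  d = (col u).+1 \/ d.+1 = col u ->
  exists v, [/\ v \in climb T, col v = d & prec v u].
Proof.
rewrite inE => /implyP h wu wd hd; move/forallP: (h wu) => {}h.
have /= := h (d == (col u).+1); set d' := (if _ then _ else _).
have -> : d' = d by rewrite /d'; case: eqP => // ne; lia.
have -> : d != col u by lia.
rewrite wd /= => /existsP[v /and3P[vc /eqP cv pv]].
by exists v; rewrite cv.
Qed.

Lemma climbSN T u : u \notin climb T.+1 -> in_window (col u) /\
  exists d, [/\ in_window d, d = (col u).+1 \/ d.+1 = col u
    & forall v, v \in climb T -> col v = d -> ~ prec v u].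
Proof.
rewrite inE negb_imply => /andP[wu /forallPn[b /=]].
set d := (if _ then _ else _).
rewrite negb_imply => /andP[/andP[wd ne] /existsPn h].
split=> //; exists d; split=> //; first by rewrite /d in ne *; case: (b) ne; lia.
by move=> v vc cv pv; have := h v; rewrite vc cv eqxx pv.
Qed.

Lemma climb_outside T u : ~~ in_window (col u) -> u \in climb T.
Proof. by case: T => [|T] /negbTE wu; rewrite inE ?wu. Qed.

Lemma climb_up T u v : col u = col v -> prec u v -> u \in climb T -> v \in climb T.
Proof.
case: T => [|T] cuv puv; rewrite !inE // cuv => /implyP h; apply/implyP => wv.
apply/forallP => b; apply/implyP => wd.
move/forallP: (h wv) => /(_ b) /=; rewrite wd /=.
case/existsP => w /and3P[wc /eqP cw pw].
apply/existsP; exists w; rewrite wc cw eqxx /=.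
by apply: (prec_trans _ pw puv); have := prec_near pw; rewrite /near cuv.
Qed.

Lemma climb_anti T u : u \in climb T.+1 -> u \in climb T.
Proof.
elim: T u => [|T IH] u; first by rewrite inE.
rewrite ![_ \in climb _.+1]inE => /implyP h; apply/implyP => wu.
apply/forallP => b; apply/implyP => wd.
move/forallP: (h wu) => /(_ b) /=; rewrite wd /=.
case/existsP => w /and3P[wc cw pw].
by apply/existsP; exists w; rewrite (IH _ wc) cw.
Qed.

(** The climb condition at [v] gives a predecessor [w] in the column of [u]. By locality [w] is not
    between [u] and [v], so [u] is at or above [w]. *)
Lemma climb_local T u v : local_edge u v -> v \in climb T ->
  in_window (col v) -> col u = (col v).+1 \/ (col u).+1 = col v ->
  u \in climb T.-1.
Proof.
case=> nuv noB vT wv cuv.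
case: (boolP (in_window (col u))) => [wu|]; last exact: climb_outside.
case: T vT => [|T] vT; first by rewrite inE.
have [w [wT cw pwv]] := climbSP vT wv wu cuv.
have [->//|[pu|pu]] : u = w \/ prec u w \/ prec w u.
    by apply: prec_total; apply: near_col (erefl _) cw _; left.
  by case: (noB w) => [|[]]; [rewrite cw; auto|split].
exact: climb_up pu wT.
Qed.

(* Induction on the length [T] of a curve that climbs from the bottom of the
   window to column [c]: [N] lists the vertices met by the curve, and [A] is
   what lies to its left if it is continued straight along column [c]. *)
Lemma climb_cut T c : in_window c -> exists (A N : {set V}),
  [/\ #|N| <= T,
      forall w, w \in climb T.-1 -> col w <> c -> (w \in A) = (col w < c)
    & forall u v, local_edge u v -> (u \in A) != (v \in A) ->
        [\/ u \in N, v \in N, (u \in climb T) && (col u == c)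
          | (v \in climb T) && (col v == c)]].
Proof.
(* If nothing in column [d] has been reached, the curve is the straight line along [d]. *)
have base S d : (forall w, col w = d -> w \in climb S) -> exists (A N : {set V}),
  [/\ #|N| <= S,
      forall w, w \in climb S.-1 -> col w <> d -> (w \in A) = (col w < d)
    & forall u v, local_edge u v -> (u \in A) != (v \in A) ->
        [\/ u \in N, v \in N, (u \in climb S) && (col u == d)
          | (v \in climb S) && (col v == d)]].
  move=> hd; exists [set w | col w < d], set0; split; first by rewrite cards0.
    by move=> w _ _; rewrite inE.
  move=> u v [nuv _]; rewrite !inE /near in nuv * => ne.
  have [cu|cv] : col u = d \/ col v = d by lia.
    by apply: Or43; rewrite hd // cu eqxx.
  by apply: Or44; rewrite hd // cv eqxx.
elim: T c => [|T IH] c wc; first by apply: base => w _; rewrite inE.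
pose Q := [set u | (col u == c) && (u \notin climb T.+1)].
case: (set_0Vmem Q) => [Q0|[q0 q0Q]].
  apply: base => w cw; apply/negPn/negP => wn.
  by have : w \in Q; [rewrite inE cw eqxx | rewrite Q0 inE].
have [q qQ maxq] : exists2 q, q \in Q & forall u, u \in Q -> X u <= X q.
  by case: (arg_maxnP X q0Q) => q qQ hq; exists q.
have [cq qn] : col q = c /\ q \notin climb T.+1.
  by move: qQ; rewrite inE => /andP[/eqP].
have [_ [d [wd hd dq]]] := climbSN qn; rewrite cq in hd.
have [A [N [cardN invA cutA]]] := IH d wd.
(* The old curve ends by running up along [E]. The new one turns below [E] into column [c] above
   [q], so [E] falls on its own side of [c]; the first vertex of [E] is the one addition to the
   cover. *)
pose E := [set u | (col u == d) && (u \in climb T)].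
pose E1 := [set u in E | [forall w in E, X u <= X w]].
pose B := [set u | if u \in E then d < c else u \in A].
have BE u : (u \in B) = if u \in E then d < c else u \in A by rewrite in_set.
exists B, (N :|: E1); split.
- apply: leq_trans (card_setU_le _ _) _; rewrite -addn1 leq_add //.
  apply: card_le1 => u v; rewrite !inE => /andP[uE /forallP hu] /andP[vE /forallP hv].
  apply: X_inj; apply/eqP; rewrite eqn_leq.
  by have := hu v; have := hv u; rewrite !inE uE vE /= => -> ->.
- move=> w /= wT cw; rewrite BE; case: ifP => [|wE].
    by rewrite inE => /andP[/eqP cwd _]; lia.
  have cwd : col w <> d by move=> cwd; rewrite inE cwd eqxx wT in wE.
  rewrite invA //; first lia.
  by case: (T) wT => // T' /climb_anti.
(* By symmetry, only edges that leave [E] have to be examined. *)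
suff key_case u v : local_edge u v -> u \notin E -> v \in E ->
    (u \in A) != (d < c) ->
    v \in E1 \/ (u \in climb T.+1) && (col u == c).
  move=> u v luv; rewrite !BE.
  case: ifP => uE; case: ifP => vE.
  - by rewrite eqxx.
  - rewrite eq_sym => ne.
    case: (key_case v u) => //; first exact: local_edgeC.
    + by rewrite vE.
    + by move=> h; apply: Or41; rewrite inE h orbT.
    + by move=> h; apply: Or44.
  - move=> ne; case: (key_case u v) => //.
    + by rewrite uE.
    + by move=> h; apply: Or42; rewrite inE h orbT.
    + by move=> h; apply: Or43.
  - move=> ne; case: (cutA u v luv ne) => h.
    + by apply: Or41; rewrite inE h.
    + by apply: Or42; rewrite inE h.
    + by move: uE; rewrite inE andbC h.
    + by move: vE; rewrite inE andbC h.
move=> luv; have [nuv noB] := luv; move=> uE vE ne.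
case: (boolP (v \in E1)) => [|vE1]; first by left.
have [cv vT] : col v = d /\ v \in climb T by move: vE; rewrite inE => /andP[/eqP].
have [y yE yv] : exists2 y, y \in E & prec y v.
  move: vE1; rewrite inE vE /= => /forallPn[y]; rewrite negb_imply -ltnNge => /andP[yE lt].
  exists y => //; rewrite prec_sameX //.
  by move: yE; rewrite inE cv => /andP[/eqP].
have [cy yT] : col y = d /\ y \in climb T by move: yE; rewrite inE => /andP[/eqP].
(* If [u] is in column [d] below [E], or in column [c] up to [q], then [y] lies between [u] and [v],
   against locality. Beyond [d], [invA] already puts [u] on the side of [E]. *)
have [cu|[cu|cu]] := near_cases nuv cv hd.
- have [e|[pu|pu]] : u = y \/ prec u y \/ prec y u.
    by apply: prec_total; apply: near_col cu cy _; left.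
  + by move: uE; rewrite e yE.
  + by case: (noB y) => [|[]]; [rewrite cy; auto|split].
  + by move: uE; rewrite inE cu eqxx /= (climb_up _ pu yT) // cu.
- case: (boolP (u \in climb T.+1)) => uT; first by right; rewrite cu eqxx.
  have uQ : u \in Q by rewrite inE cu eqxx.
  have qy : prec q y.
    have [e|[|/(dq _ yT cy)]] : q = y \/ prec q y \/ prec y q => //.
      by apply: prec_total; apply: near_col cq cy _; right.
    by case: hd; rewrite -cq -cy e => /eqP; rewrite -?[_ == _.+1]eq_sym (gtn_eqF (ltnSn _)).
  have uy : prec u y.
    have := maxq _ uQ; rewrite leq_eqVlt => /orP[/eqP/X_inj->//|].
    rewrite -prec_sameX ?cu ?cq // => uq.
    by apply: prec_trans uq qy; apply: near_col cu cy _; right.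
  by case: (noB y) => [|[]]; [rewrite cy; auto|split].
have uT : u \in climb T.-1.
  apply: (climb_local luv vT); first by rewrite cv.
  by rewrite cv; move: hd cu; clear; lia.
by move: ne; rewrite invA //; move: hd cu; clear; lia.
Qed.

End Window.

(** * Sweeping from one cut to the next *)

Definition thin := covers_boundary grid_adj.

Definition down_closed (D : {set V}) := [forall u, forall v in D, prec u v ==> (u \in D)].

Lemma down_closedP D u v : down_closed D -> v \in D -> prec u v -> u \in D.
Proof. by move=> /forallP/(_ u)/forallP/(_ v) + vD puv; rewrite vD puv. Qed.

(** An edge leaving [A1] or [A2] is covered by [N1] or [N2]. Any other boundary edge stays in the
    [m] columns of the gap: a local one starts at the last vertex of [D] in its column, since [D] is
    down-closed, and a jump ends at the first vertex of a column. *)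
Lemma sweep_thin (A1 A2 D N1 N2 : {set V}) b m :
  thin A1 N1 -> thin A2 N2 -> down_closed D ->
  (forall u, u \in A2 -> u \notin A1 -> b <= col u < b + m) ->
  exists2 N : {set V}, #|N| <= #|N1| + #|N2| + 2 * m & thin (A1 :|: A2 :&: D) N.
Proof.
move=> th1 th2 dD hcol.
pose W := [set u | b <= col u < b + m].
pose N3 := [set u in W | column_first u].
pose N4 := [set u in W | (u \in D) && [forall w in D, (col w == col u) ==> (X w <= X u)]].
exists (N1 :|: N2 :|: (N3 :|: N4)).
  have N3m : #|N3| <= m.
    apply: (@card_per_column _ b) => [u|u v]; first by rewrite !inE => /andP[].
    rewrite !inE => /andP[_ /forallP hu] /andP[_ /forallP hv] cuv.
    apply: X_inj; apply/eqP; rewrite eqn_leq.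
    by have := hu v; have := hv u; rewrite cuv eqxx /= => -> ->.
  have N4m : #|N4| <= m.
    apply: (@card_per_column _ b) => [u|u v]; first by rewrite !inE => /andP[].
    rewrite !inE => /and3P[_ uD /forallP hu] /and3P[_ vD /forallP hv] cuv.
    apply: X_inj; apply/eqP; rewrite eqn_leq.
    by have := hu v; have := hv u; rewrite uD vD cuv eqxx /= => -> ->.
  have := card_setU_le (N1 :|: N2) (N3 :|: N4); have := card_setU_le N1 N2.
  by have := card_setU_le N3 N4; lia.
move=> u v auv; rewrite !inE negb_or => uA /andP[vA1].
case: (boolP (u \in A1)) uA => /= [uA1 _ _|uA1].
  by case: (th1 u v auv uA1 vA1) => ->; [left|right].
move=> /andP[uA2 uD]; rewrite negb_and.
case: (boolP (v \in A2)) => [vA2|vA2 _] /=; last first.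
  by case: (th2 u v auv uA2 vA2) => ->; rewrite !orbT; [left|right].
move=> vD.
have uW := hcol u uA2 uA1; have vW := hcol v vA2 vA1.
case: (edge_cases auv) => [luv|[juv|jvu]].
- left; rewrite uW uD /=; apply/orP; right; apply/orP; right.
  apply/forallP => w; apply/implyP => wD; apply/implyP => /eqP cw.
  rewrite leqNgt; apply/negP => lt.
  have uw : prec u w by rewrite prec_sameX.
  have [nuv noB] := luv.
  have [e|[wv|vw]] : w = v \/ prec w v \/ prec v w.
  + by apply: prec_total; rewrite /near cw.
  + by rewrite -e wD in vD.
  + by case: (noB w) => [|[]]; [left|split].
  + by rewrite (down_closedP dD wD vw) in vD.
- by right; rewrite (jump_first juv) vW !orbT.
- by left; rewrite (jump_first jvu) uW !orbT.
Qed.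

(** Take a largest down-closed [D] for which [P] fails. Adding a [prec]-minimal vertex outside [D]
    keeps it down-closed, so by maximality [P] then holds. *)
Lemma sweep_step (P : pred {set V}) (A1 A2 N1 N2 : {set V}) b m :
  thin A1 N1 -> thin A2 N2 -> A1 \subset A2 ->
  (forall u, u \in A2 -> u \notin A1 -> b <= col u < b + m) ->
  ~~ P A1 -> P A2 ->
  exists (A B N : {set V}) v, [/\ ~~ P A, P B, B \subset v |: A, thin B N
    & #|N| <= #|N1| + #|N2| + 2 * m].
Proof.
move=> th1 th2 A12 hcol P1 P2.
pose S D := A1 :|: A2 :&: D.
pose Q D := down_closed D && ~~ P (S D).
have Q0 : Q set0.
  rewrite /Q /S setI0 setU0 P1 andbT; apply/forallP => u; apply/forallP => v.
  by rewrite inE.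
case: (arg_maxnP (fun D : {set V} => #|D|) Q0) => D /andP[dD PD] maxD.
have [v vD minv] : exists2 v, v \in ~: D & forall u, u \in ~: D -> ~ prec u v.
  apply: prec_min; case: (set_0Vmem (~: D)) => [D0|[u uD]]; last by exists u.
  move: PD; rewrite /S -[D]setCK D0 setC0 setIT.
  by move/setUidPr: A12 => ->; rewrite P2.
have dvD : down_closed (v |: D).
  apply/forallP => u; apply/forallP => w; apply/implyP => wD; apply/implyP => puw.
  rewrite inE; case: (boolP (u \in D)) => uD; rewrite ?orbT ?orbF //.
  move: wD; rewrite !inE => /orP[/eqP e|wD].
    by case: (minv u); [rewrite inE | rewrite -e].
  by rewrite (down_closedP dD wD puw) in uD.
have [N cN thN] := sweep_thin th1 th2 dvD hcol.
exists (S D), (S (v |: D)), N, v; split=> //.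
  apply/negPn/negP => PvD; have := maxD (v |: D); rewrite /Q dvD PvD => /(_ isT).
  by rewrite cardsU1; rewrite inE in vD; rewrite vD; lia.
by apply/subsetP => u; rewrite !inE; case: (u == v); case: (u \in A1); case: (u \in A2).
Qed.

Definition separates a k M (A N : {set V}) :=
  [/\ #|N| <= M, forall u, col u < a -> u \in A, forall u, u \in A -> col u < a + k
    & thin A N].

(** Windows of width [k] start at every multiple of [2 * k], an even column. Successive cuts are
    therefore nested and differ within [3 * k] columns, which costs [6 * k] in [sweep_thin]. *)
Lemma sweep (P : pred {set V}) k M :
  (forall j, exists A N, separates (2 * k * j) k M A N) -> 0 < k ->
  ~~ P set0 -> P [set: V] ->
  exists (A B N : {set V}) v, [/\ ~~ P A, P B, B \subset v |: A, thin B N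
    & #|N| <= 2 * M + 6 * k].
Proof.
move=> sep k0 P0 PT; set G := (exists _, _).
have ind j : G \/ exists A N, separates (2 * k * j) k M A N /\ ~~ P A.
  elim: j => [|j [|[A1 [N1 [[cN1 loA1 hiA1 th1] PA1]]]]].
  - have [A [N sA]] := sep 0; case: (boolP (P A)) => PA; last by right; exists A, N.
    left; have [cN loA hiA thA] := sA.
    have th0 : thin set0 set0 by move=> u v _; rewrite inE.
    have [||A' [B [N' [v [? ? ? ? cN']]]]] := @sweep_step P _ _ _ _ 0 (3 * k) th0 thA _ _ P0 PA.
    + exact: sub0set.
    + by move=> u /hiA; lia.
    exists A', B, N', v; split=> //; move: cN'; rewrite cards0; lia.
  - by left.
  - have [A [N sA]] := sep j.+1; case: (boolP (P A)) => PA; last by right; exists A, N.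
    left; have [cN loA hiA thA] := sA.
    have [||A' [B [N' [v [? ? ? ? cN']]]]] :=
        @sweep_step P _ _ _ _ (2 * k * j) (3 * k) th1 thA _ _ PA1 PA.
    + apply/subsetP => u /hiA1 cu; apply: loA; lia.
    + move=> u /hiA cu uA1; have : ~~ (col u < 2 * k * j) by apply: contra uA1 => /loA1.
      by lia.
    exists A', B, N', v; split=> //; lia.
case: (ind (\max_u col u).+1) => // -[A [N [[_ loA _ _] PA]]].
suff e : A = [set: V] by rewrite e PT in PA.
apply/setP => u; rewrite inE loA //.
have : col u <= \max_v col v by exact: (leq_bigmax (F := col)).
by nia.
Qed.

(** When column [c] is fully reached, the curve of [climb_cut] covers all local edges with [T]
    vertices. Jumps touching the window use a first or last vertex of one of its [k] columns, and
    jumps over it start at one of two vertices. *)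
Lemma window_cut a k T c : 0 < k -> ~~ odd a -> in_window a k c ->
  (forall u, col u = c -> u \notin climb a k T) ->
  exists A N, separates a k (T + 2 * k + 2) A N.
Proof.
move=> k0 ea wc cT.
have [A [N0 [cN0 invA cutA]]] := climb_cut T wc.
have out u : ~~ in_window a k (col u) -> (u \in A) = (col u < a).
  move=> wu; rewrite invA; [|exact: climb_outside|].
    by move: wu wc; rewrite /in_window; lia.
  by move=> e; rewrite e wc in wu.
pose N1 := [set u | in_window a k (col u) && column_first u].
pose N2 := [set u | in_window a k (col u) && column_last u].
pose N3 := [set u | lastX a u].
pose N4 := [set u | lastY a u].
exists A, (N0 :|: (N1 :|: N2) :|: (N3 :|: N4)); split.
- have N1k : #|N1| <= k.
    apply: (@card_per_column _ a) => [u|u v]; first by rewrite !inE => /andP[].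
    rewrite !inE => /andP[_ /forallP hu] /andP[_ /forallP hv] cuv.
    apply: X_inj; apply/eqP; rewrite eqn_leq.
    by have := hu v; have := hv u; rewrite cuv eqxx /= => -> ->.
  have N2k : #|N2| <= k.
    apply: (@card_per_column _ a) => [u|u v]; first by rewrite !inE => /andP[].
    rewrite !inE => /andP[_ /forallP hu] /andP[_ /forallP hv] cuv.
    apply: X_inj; apply/eqP; rewrite eqn_leq.
    by have := hu v; have := hv u; rewrite cuv eqxx /= => -> ->.
  have N31 : #|N3| <= 1.
    apply: card_le1 => u v; rewrite !inE => /andP[cu /forallP hu] /andP[cv /forallP hv].
    apply: X_inj; apply/eqP; rewrite eqn_leq.
    by have := hu v; have := hv u; rewrite cu cv /= => -> ->.
  have N41 : #|N4| <= 1.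
    apply: card_le1 => u v; rewrite !inE => /andP[cu /forallP hu] /andP[cv /forallP hv].
    apply: Y_inj; apply/eqP; rewrite eqn_leq.
    by have := hu v; have := hv u; rewrite cu cv /= => -> ->.
  have := card_setU_le (N0 :|: (N1 :|: N2)) (N3 :|: N4).
  have := card_setU_le N0 (N1 :|: N2); have := card_setU_le N1 N2.
  by have := card_setU_le N3 N4; clear -cN0 N1k N2k N31 N41; lia.
- by move=> u cu; rewrite out // /in_window; lia.
- move=> u uA; rewrite ltnNge; apply/negP => cu.
  by move: uA; rewrite out; rewrite /in_window; lia.
have jump x y : jump_edge x y -> (x \in A) != (y \in A) ->
    x \in N2 :|: (N3 :|: N4) \/ y \in N1.
  move=> jxy ne; have cxy := jump_col jxy.
  case: (boolP (in_window a k (col y))) => wy.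
    by right; rewrite inE wy (jump_first jxy).
  left; case: (boolP (in_window a k (col x))) => wx.
    by rewrite !inE wx (jump_last jxy).
  rewrite !out // in ne.
  have /andP[cx cy] : (col x < a) && (a < col y).
    by move: ne wx wy; rewrite /in_window; clear -cxy k0; lia.
  by rewrite !inE (jump_over ea jxy cx cy) orbT.
move=> u v auv uA vA; have ne : (u \in A) != (v \in A) by rewrite uA (negbTE vA).
case: (edge_cases auv) => [luv|[juv|jvu]].
- case: (cutA u v luv ne) => [h|h|/andP[h /eqP/cT]|/andP[h /eqP/cT]]; rewrite ?h //.
    by left; rewrite !in_setU h.
  by right; rewrite !in_setU h.
- case: (jump u v juv ne) => h; [left|right]; last by rewrite !in_setU h !orbT.
  by move: h; rewrite !in_setU => /orP[->|->]; rewrite ?orbT.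
- rewrite eq_sym in ne.
  case: (jump v u jvu ne) => h; [right|left]; last by rewrite !in_setU h !orbT.
  by move: h; rewrite !in_setU => /orP[->|->]; rewrite ?orbT.
Qed.

(** * Threads across a window *)

Lemma climb_threads a k : 0 < k ->
  (forall c T, in_window a k c -> T < 3 * k -> exists2 u, u \in climb a k T & col u = c) ->
  exists x : nat -> nat -> V,
    [/\ forall c i, c < k -> i < k -> col (x c i) = a + c,
        forall c i, c.+1 < k -> i < k -> prec (x c i) (x c.+1 i)
      & forall c i, c.+1 < k -> i.+1 < k -> prec (x c.+1 i) (x c i.+1)].
Proof.
move=> k0 full.
have [||u0 _ _] := full a 0; rewrite /in_window; try lia.
pose h c T := [arg min_(u < odflt u0 [pick u | (u \in climb a k T) && (col u == c)]
                        | (u \in climb a k T) && (col u == c)) X u].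
have hP c T : in_window a k c -> T < 3 * k ->
    [/\ h c T \in climb a k T, col (h c T) = c
      & forall u, u \in climb a k T -> col u = c -> u = h c T \/ prec (h c T) u].
  move=> wc T3; have [u uT cu] := full c T wc T3.
  rewrite /h; case: arg_minnP.
    by case: pickP => [//|/(_ u)]; rewrite uT cu eqxx.
  move=> v /andP[vT /eqP cv] minv; split=> // w wT cw.
  have := minv w; rewrite wT cw eqxx => /(_ isT).
  rewrite prec_sameX ?cv // leq_eqVlt => /orP[/eqP/X_inj->|]; auto.
have step c d T : in_window a k c -> in_window a k d -> T.+1 < 3 * k ->
    d = c.+1 \/ d.+1 = c -> prec (h d T) (h c T.+1).
  move=> wc wd T3 cd.
  have [hcT hc _] := hP c T.+1 wc T3; have [_ hd hmin] := hP d T wd (ltnW T3).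
  have [||v [vT cv pv]] := @climbSP a k T (h c T.+1) d hcT _ wd; rewrite ?hc //.
  case: (hmin v vT cv) => [<-//|p2]; apply: prec_trans p2 pv.
  by apply: near_col hd hc _; clear -cd; lia.
(* Going right on a thread, or left to the next thread, takes one time unit. The latest time is
   [3 * k - 3]. *)
exists (fun c i => h (a + c) (c + 2 * i)); split.
- by move=> c i ck ik; have [] := hP (a + c) (c + 2 * i); rewrite /in_window; lia.
- move=> c i ck ik; rewrite [c.+1 + _]addSn.
  by apply: step; rewrite /in_window; lia.
- move=> c i ck ik; have -> : c + 2 * i.+1 = (c.+1 + 2 * i).+1 by lia.
  by apply: step; rewrite /in_window; lia.
Qed.

Section Threads.

Variables (a k : nat) (x : nat -> nat -> V).
Hypothesis even_a : ~~ odd a.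
Hypothesis x_col : forall c i, c < k -> i < k -> col (x c i) = a + c.
Hypothesis x_right : forall c i, c.+1 < k -> i < k -> prec (x c i) (x c.+1 i).
Hypothesis x_left : forall c i, c.+1 < k -> i.+1 < k -> prec (x c.+1 i) (x c i.+1).

Lemma threads_col_mono c i j : c < k -> i < j -> j < k -> prec (x c i) (x c j).
Proof.
move=> ck; elim: j => // j IH; rewrite ltnS leq_eqVlt => ij jk.
have jj : prec (x c j) (x c j.+1).
  have nj : near (x c j) (x c j.+1) by rewrite /near !x_col //; lia.
  case: (ltnP c.+1 k) => ck1.
    by apply: prec_trans nj (x_right _ _) (x_left _ _); lia.
  case: c {IH ij} ck ck1 nj => [|c] ck ck1 nj; first lia.
  by apply: prec_trans nj (x_left _ _) (x_right _ _); lia.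
case/orP: ij => [/eqP->//|ij]; have ij' := IH ij (ltnW jk).
by apply: prec_trans ij' jj; rewrite /near !x_col //; lia.
Qed.

Lemma threads_prec c i d j : c < k -> i < k -> d < k -> j < k ->
  c <= d.+1 -> d <= c.+1 -> i < j \/ (i = j /\ c < d) -> prec (x c i) (x d j).
Proof.
move=> ck ik dk jk cd dc ij.
have ncd : near (x c i) (x d j) by rewrite /near !x_col //; lia.
have [e|[e|e]] : c = d \/ d = c.+1 \/ c = d.+1 by lia.
- by rewrite e in ck *; apply: threads_col_mono => //; lia.
- rewrite e in ncd dk *; have r := x_right dk ik.
  have [lt|<-//] : i < j \/ i = j by lia.
  exact: prec_trans ncd r (threads_col_mono _ _ _).
- rewrite e in ncd ck *; have ij' : i < j by lia.
  have l : prec (x d.+1 i) (x d i.+1) by apply: x_left => //; lia.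
  have [lt|<-//] : i.+1 < j \/ i.+1 = j by lia.
  exact: prec_trans ncd l (threads_col_mono _ _ _).
Qed.

(** As [a] is even, the strips of the window pair the columns as [c./2] and [uphalf c] do: [X] sorts
    the threads by strip, then level, then column, and [Y] likewise below. *)
Lemma threads_lexX c i d j : c < k -> i < k -> d < k -> j < k ->
  c./2 < d./2 \/ (c./2 = d./2 /\ (i < j \/ (i = j /\ c < d))) ->
  X (x c i) < X (x d j).
Proof.
move=> ck ik dk jk [lt|[e ij]].
  rewrite ltnNge leq_eqVlt; apply/negP => /orP[/eqP/X_inj/(congr1 col)|/colX];
    rewrite !x_col //; lia.
have : prec (x c i) (x d j) by apply: threads_prec => //; lia.
rewrite (@precE (a + c./2.*2)) ?x_col //; try lia.
by rewrite /key oddD odd_double (negbTE even_a).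
Qed.

Lemma threads_lexY c i d j : c < k -> i < k -> d < k -> j < k ->
  uphalf c < uphalf d \/ (uphalf c = uphalf d /\ (i < j \/ (i = j /\ c < d))) ->
  Y (x c i) < Y (x d j).
Proof.
move=> ck ik dk jk [lt|[e ij]].
  rewrite ltnNge leq_eqVlt; apply/negP => /orP[/eqP/Y_inj/(congr1 col)|/colY];
    rewrite !x_col //; lia.
have : prec (x c i) (x d j) by apply: threads_prec => //; lia.
case: (posnP (uphalf c)) => [z|pos].
  by rewrite prec_sameY // !x_col //; lia.
rewrite (@precE (a + (uphalf c).-1.*2.+1)) ?x_col //; try lia.
by rewrite /key oddD /= odd_double (negbTE even_a).
Qed.

End Threads.

End Gridding.

(** * Staircase coordinates of the [k]-track *)

(* The entry of the [k]-track in position [t] is vertex [track_lev k t] of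
   column [track_col k t] of a staircase with [k] columns of [k] points. *)
Definition track_col k t :=
  if odd k && (k ^ 2 - k <= t) then k.-1 else 2 * (t %/ (2 * k)) + odd t.
Definition track_lev k t :=
  if odd k && (k ^ 2 - k <= t) then t - (k ^ 2 - k) else (t %% (2 * k))./2.

Lemma track_coord_arith k q r t : t = q * (2 * k) + r ->
  let c := 2 * q + odd r in
  [/\ c./2 = q, t = 2 * k * c./2 + (2 * r./2 + odd c)
    & (if odd t then 2 * k + t.-1 else t.+1) = 2 * k * uphalf c + 2 * r./2 + ~~ odd c].
Proof.
move=> tqr c.
have odd_t : odd t = odd r by rewrite tqr oddD !oddM andbF.
have c2 : c./2 = q by rewrite /c; case: odd; lia.
have cu : uphalf c = q + odd r by rewrite /c; case: odd; lia.
have oc : odd c = odd r by rewrite /c oddD oddM; case: (odd r).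
rewrite c2 cu oc odd_t; have rE := odd_double_half r; rewrite -mul2n in rE.
move: tqr; clear -rE; move: (r./2) rE => s.
by case: (odd r) => rE tqr; split=> //; nia.
Qed.

(** Positions run through the vertical strips and entries through the horizontal ones, level by
    level. For odd [k] the last column is alone in its vertical strip, so its positions are
    consecutive. *)
Lemma track_coordP k (t : 'I_(k ^ 2)) :
  let c := track_col k t in let i := track_lev k t in
  [/\ c < k, i < k,
      t = 2 * k * c./2 + (if odd k && (c == k.-1) then i else 2 * i + odd c) :> nat
    & track_entry t = 2 * k * uphalf c + 2 * i + ~~ odd c].
Proof.
case: t => t /= tk; rewrite /track_entry /track_col /track_lev /=.
have k0 : 0 < k by case: (k) tk.
have rk : t %% (2 * k) < 2 * k by rewrite ltn_mod muln_gt0.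
have := track_coord_arith (divn_eq t (2 * k)).
move: (t %/ (2 * k)) (t %% (2 * k)) rk (divn_eq t (2 * k)) => q r rk tqr.
have -> : odd r = odd t by rewrite tqr oddD !oddM andbF.
move=> /= [c2 tE eE]; have rk' : r./2 < k by clear -rk; lia.
case: (boolP (odd k)) => ok /=; last first.
  split=> //; have qk : q < k./2.
    rewrite ltnNge; apply/negP => hq; move: tk; rewrite -mulnn.
    by have := leq_mul hq (leqnn (2 * k)); clear -tqr ok; nia.
  by clear -qk; case: odd; lia.
have kk : k ^ 2 - k = 2 * k * k./2 by rewrite -mulnn; clear -ok; nia.
have kk2 : k ^ 2 = 2 * k * k./2 + k by rewrite -mulnn; clear -ok; nia.
rewrite kk kk2 in tk *; case: ifP => le.
  have [h1 h2 h3] : [/\ k.-1./2 = k./2, uphalf k.-1 = k./2 & odd k.-1 = false].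
    by clear -ok; split; lia.
  by rewrite eqxx h1 h2 h3; split; clear -k0 tk le; lia.
have qk : q < k./2.
  rewrite ltnNge; apply/negP => hq; have := leq_mul hq (leqnn (2 * k)).
  by clear -tqr le; lia.
have -> : (2 * q + odd t == k.-1) = false by clear -qk ok; case: odd; lia.
by split=> //; clear -qk; case: odd; lia.
Qed.

Lemma track_position_lex k c i d j : c < k -> i < k -> d < k -> j < k ->
  2 * k * c./2 + (if odd k && (c == k.-1) then i else 2 * i + odd c) <
  2 * k * d./2 + (if odd k && (d == k.-1) then j else 2 * j + odd d) ->
  c./2 < d./2 \/ (c./2 = d./2 /\ (i < j \/ (i = j /\ c < d))).
Proof.
move=> ck ik dk jk lt; case: (ltngtP c./2 d./2) => [|dc|cd]; first by left.
  have := leq_mul (leqnn (2 * k)) dc; rewrite mulnS.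
  by move: lt; clear -ik jk; case: ifP; case: ifP; lia.
right; split=> //; move: lt; rewrite cd ltn_add2l.
by clear -ck ik dk jk cd; case: ifP => hc; case: ifP => hd; lia.
Qed.

Lemma track_entry_lex k c i d j : i < k -> j < k ->
  2 * k * uphalf c + 2 * i + ~~ odd c < 2 * k * uphalf d + 2 * j + ~~ odd d ->
  uphalf c < uphalf d \/ (uphalf c = uphalf d /\ (i < j \/ (i = j /\ c < d))).
Proof.
move=> ik jk lt; case: (ltngtP (uphalf c) (uphalf d)) => [|dc|cd]; first by left.
  have := leq_mul (leqnn (2 * k)) dc; rewrite mulnS.
  by move: lt; clear -ik jk; lia.
right; split=> //; move: lt; rewrite cd -!addnA ltn_add2l.
by clear -cd; lia.
Qed.

(** * A staircase gridding of a [321]-avoiding permutation *)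

Section Staircase.

Variables (V : finType) (X Y : V -> nat).
Hypotheses (X_inj : injective X) (Y_inj : injective Y).
Hypothesis no321 : forall u v w, X u < X v -> X v < X w -> Y v < Y u -> Y v <= Y w.

(** These are the right-to-left minima. The remaining, upper, points also form an increasing
    sequence because there is no [321]. *)
Definition lower u := [forall v, (X u < X v) ==> (Y u < Y v)].

Lemma lower_incr u v : lower u -> X u < X v -> Y u < Y v.
Proof. by move=> /forallP/(_ v)/implyP; apply. Qed.

Lemma lowerN u : ~~ lower u -> exists v, [/\ X u < X v, Y v < Y u & lower v].
Proof.
case/forallPn=> v; rewrite negb_imply -leqNgt => /andP[Xuv].
rewrite leq_eqVlt => /orP[/eqP/Y_inj e|Yvu].
  by rewrite e ltnn in Xuv.
exists v; split=> //; apply/forallP => w; apply/implyP => Xvw.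
have := no321 Xuv Xvw Yvu; rewrite leq_eqVlt => /orP[/eqP/Y_inj e|//].
by rewrite e ltnn in Xvw.
Qed.

Lemma upper_incr u v : ~~ lower u -> ~~ lower v -> X u < X v -> Y u < Y v.
Proof.
move=> _ /lowerN[w [Xvw Ywv _]] Xuv; rewrite ltnNge leq_eqVlt.
apply/negP => /orP[/eqP/Y_inj e|Yvu]; first by rewrite e ltnn in Xuv.
by have := no321 Xuv Xvw Yvu; lia.
Qed.

Let top := (\max_v Y v).+1.

Let Y_top v : Y v < top.
Proof. by rewrite ltnS; apply: (leq_bigmax (F := Y)). Qed.

(** The disjunct [top <= y] makes the search succeed when no upper point qualifies. *)
Definition next_start t y := (top <= y) || [exists u, [&& ~~ lower u, Y u == y
  & [forall l, (lower l && (Y l < t)) ==> (X l < X u)]]].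

Lemma next_start_ex t : exists y, next_start t y.
Proof. by exists top; rewrite /next_start leqnn. Qed.

(* The value of the first upper point to the right of all lower points of
   value less than [t]: the horizontal lines of the gridding are obtained
   by iterating this map. *)
Definition next_line t := ex_minn (next_start_ex t).

Lemma next_lineN t u : ~~ lower u -> Y u < next_line t ->
  exists l, [/\ lower l, Y l < t & X u < X l].
Proof.
rewrite /next_line; case: ex_minnP => y _ miny nu Yu.
have : ~~ next_start t (Y u) by apply/negP => /miny; lia.
rewrite negb_or => /andP[_ /existsPn/(_ u)]; rewrite nu eqxx /=.
case/forallPn=> l; rewrite negb_imply -leqNgt => /andP[/andP[ll lt]].
rewrite leq_eqVlt => /orP[/eqP/X_inj e|]; last by exists l.
by rewrite e ll in nu.
Qed.

Lemma next_lineP t u l : ~~ lower u -> next_line t <= Y u -> lower l -> Y l < t ->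
  X l < X u.
Proof.
rewrite /next_line; case: ex_minnP => y /orP[ty|/existsP[v /and3P[nv /eqP <- /forallP hv]]] _.
  by move=> _ yu; have := Y_top u; lia.
move=> nu Yvu ll lt; have Xlv : X l < X v by have := hv l; rewrite ll lt.
apply: leq_trans Xlv _; rewrite leqNgt; apply/negP => Xuv.
by have := upper_incr nu nv Xuv; lia.
Qed.

(** An upper point that starts a line has a smaller lower point to its right, whose value must be at
    least [t]. *)
Lemma next_line_gt t : t < next_line t \/ top <= next_line t.
Proof.
rewrite /next_line; case: ex_minnP => y /orP[|/existsP[v]]; first by right.
case/and3P=> nv /eqP <- /forallP hv _; left.
have [l [Xvl Ylv ll]] := lowerN nv.
rewrite ltnNge; apply/negP => Yvt.
by have := hv l; rewrite ll /= (leq_trans Ylv Yvt) /=; lia.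
Qed.

Definition line i := iter i.+1 next_line 0.

Lemma line_ge i : i < line i \/ top <= line i.
Proof.
elim: i => [|i IH]; first exact: next_line_gt.
by have := next_line_gt (line i); rewrite [line i.+1]iterS -/(line i); lia.
Qed.

Lemma level_ex v : exists i, Y v < line i.
Proof. by exists top; have := Y_top v; case: (line_ge top); lia. Qed.

Definition level v := ex_minn (level_ex v).

Lemma levelP v : Y v < line (level v).
Proof. by rewrite /level; case: ex_minnP. Qed.

Lemma level_min v i : Y v < line i -> level v <= i.
Proof. by rewrite /level; case: ex_minnP => j _; apply. Qed.

Lemma level_line v i : i < level v -> line i <= Y v.
Proof. by move=> iv; rewrite leqNgt; apply/negP => /level_min; lia. Qed.

Lemma upper_level v : ~~ lower v -> 0 < level v.
Proof.
move=> nv; rewrite lt0n; apply/negP => /eqP z.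
have := levelP v; rewrite z => /(next_lineN nv)[l []]; lia.
Qed.

Lemma level_mono u v : Y u < Y v -> level u <= level v.
Proof. by move=> uv; apply/level_min/(ltn_trans uv)/levelP. Qed.

(** Upper and lower points of level [m] get columns [2m-1] and [2m], a horizontal strip; lower
    points of level [m] and upper points of level [m+1] form a vertical strip. *)
Definition stair u := if lower u then (level u).*2 else (level u).*2.-1.

Lemma stairX u v : X u < X v -> (stair u)./2 <= (stair v)./2.
Proof.
move=> Xuv; rewrite /stair.
have uu := @upper_level u; have vv := @upper_level v.
case: ifPn => lu; case: ifPn => lv.
- by have := level_mono (lower_incr lu Xuv); lia.
(* Otherwise [next_lineN] gives a lower point right of [v], hence of [u], but with a smaller value
   than the lower point [u]. *)
- suff : level u < level v by lia.
  rewrite ltnNge; apply/negP => le.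
  have {}vv := vv lv; have := levelP v; rewrite -(prednK vv).
  case/(next_lineN lv) => l [ll Yl Xvl].
  have Ylu : Y l < Y u by apply: leq_trans Yl _; apply: level_line; lia.
  have := lower_incr lu (ltn_trans Xuv Xvl); lia.
- suff : level u <= (level v).+1 by have := uu lu; lia.
  apply: level_min; rewrite ltnNge; apply/negP => le.
  by have := next_lineP lu le lv (levelP v); lia.
- by have := level_mono (upper_incr lu lv Xuv); lia.
Qed.

Lemma stairY u v : Y u < Y v -> uphalf (stair u) <= uphalf (stair v).
Proof.
move=> /level_mono le; have uu := @upper_level u; have vv := @upper_level v.
by rewrite /stair; case: ifPn => lu; case: ifPn => lv; lia.
Qed.

Lemma stair_incr u v : stair u = stair v -> X u < X v -> Y u < Y v.
Proof.
have uu := @upper_level u; have vv := @upper_level v.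
rewrite /stair; case: ifPn => lu; case: ifPn => lv e.
- exact: lower_incr.
- by have := vv lv; lia.
- by have := uu lu; lia.
- exact: upper_incr.
Qed.

End Staircase.

(** * Connected sets carried through subdivisions *)

Section SubdividedLines.

Variables (H W G : graph) (phi : H -> W) (P : H -> H -> seq W) (f : W -> G).
Hypothesis phi_inj : injective phi.
Hypothesis f_inj : injective f.
Hypothesis P_inner : forall u v w, adj H u v -> phi w \notin P u v.
Hypothesis P_disj : forall u v u' v', adj H u v -> adj H u' v' ->
  (exists2 x, x \in P u v & x \in P u' v') ->
  (u', v') = (u, v) \/ (u', v') = (v, u).
Hypothesis f_path : forall u v z w, adj H u v ->
  infix [:: z; w] (phi u :: rcons (P u v) (phi v)) -> adj G (f z) (f w).

Definition subdivided_set (S : {set H}) : {set G} :=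
  [set x | [exists u in S, x == f (phi u)] ||
           [exists u in S, [exists v in S, adj H u v && (x \in map f (P u v))]]].

Lemma subdivided_setP (S : {set H}) x : reflect
  ((exists2 u, u \in S & x = f (phi u)) \/
   (exists u v z, [/\ u \in S, v \in S, adj H u v, z \in P u v & x = f z]))
  (x \in subdivided_set S).
Proof.
rewrite inE; apply: (iffP orP) => -[].
- by case/existsP=> u /andP[uS /eqP->]; left; exists u.
- case/existsP=> u /andP[uS /existsP[v /and3P[vS uv /mapP[z zP ->]]]].
  by right; exists u, v, z.
- by case=> u uS ->; left; apply/existsP; exists u; rewrite uS eqxx.
- case=> u [v [z [uS vS uv zP ->]]]; right; apply/existsP; exists u.
  by rewrite uS /=; apply/existsP; exists v; rewrite vS uv map_f.
Qed.

Lemma subdivided_disjoint (S1 S2 : {set H}) x :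
  x \in subdivided_set S1 -> x \in subdivided_set S2 ->
  exists2 u, u \in S1 & u \in S2.
Proof.
case/subdivided_setP=> [[u uS ->]|[u [v [z [uS vS uv zP ->]]]]];
case/subdivided_setP=> [[u' uS' /f_inj e]|[u' [v' [z' [uS' vS' uv' zP' /f_inj e]]]]].
- by move/phi_inj: e => e; exists u; rewrite // e.
- by have := P_inner u uv'; rewrite e zP'.
- by have := P_inner u' uv; rewrite -e zP.
- have [||] := P_disj uv uv'; first by exists z; rewrite // e.
    by case=> e1 _; exists u; rewrite // -e1.
  by case=> e1 _; exists v; rewrite // -e1.
Qed.

Lemma infix_constant (T : eqType) (B : pred T) x s :
  (forall z w, infix [:: z; w] (x :: s) -> B z = B w) ->
  forall z, z \in x :: s -> B z = B x.
Proof.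
elim: s x => [|y s IH] x h z; first by rewrite inE => /eqP->.
have xy : B x = B y by apply: h; rewrite /= !eqxx prefix0s.
rewrite inE => /orP[/eqP->//|zs]; rewrite xy; apply: IH => // z' w' i.
by apply: h; rewrite infix_consl // orbC i.
Qed.

(** If no edge crossed [A], membership in [A] would be constant along each subdivided edge, so the
    preimage of [A] under the branch map would be an uncrossed cut of [S]. *)
Lemma subdivided_connected (S : {set H}) :
  connected_set (adj H) S -> connected_set (adj G) (subdivided_set S).
Proof.
move=> cS A x y xS yS xA yA.
case: (boolP [exists u in subdivided_set S, [exists v in subdivided_set S,
    [&& u \in A, v \notin A & adj G u v]]]).
  case/existsP=> u /andP[uS /existsP[v /and4P[vS uA vA uv]]].
  by exists u, v.
move=> none; exfalso.
have const u v : u \in S -> v \in S -> adj H u v ->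
    forall z, z \in phi u :: rcons (P u v) (phi v) -> (f z \in A) = (f (phi u) \in A).
  move=> uS vS uv; apply: (infix_constant (B := fun z => f z \in A)) => z w zw.
  have inS t : t \in phi u :: rcons (P u v) (phi v) -> f t \in subdivided_set S.
    rewrite inE mem_rcons inE => /or3P[/eqP->|/eqP->|tP]; apply/subdivided_setP.
    - by left; exists u.
    - by left; exists v.
    - by right; exists u, v, t.
  have zS : f z \in subdivided_set S.
    by apply: inS; apply: (mem_infix zw); rewrite inE eqxx.
  have wS : f w \in subdivided_set S.
    by apply: inS; apply: (mem_infix zw); rewrite !inE eqxx orbT.
  have azw := f_path uv zw.
  apply/idP/idP => fA; apply: contraR none => fB.
    by apply/existsP; exists (f z); rewrite zS /=; apply/existsP; exists (f w); rewrite wS fA fB.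
  apply/existsP; exists (f w); rewrite wS /=; apply/existsP; exists (f z).
  by rewrite zS fA fB adj_sym.
have root z : z \in subdivided_set S -> exists2 u, u \in S & (z \in A) = (f (phi u) \in A).
  case/subdivided_setP=> [[u uS ->]|[u [v [t [uS vS uv tP ->]]]]]; exists u => //.
  by apply: (const u v) => //; rewrite inE mem_rcons inE tP !orbT.
have [u uS eu] := root x xS; have [v vS ev] := root y yS.
have [||u' [v' [uS' vS' uA vA uv]]] := cS [set t | f (phi t) \in A] u v uS vS.
- by rewrite inE -eu.
- by rewrite inE -ev.
rewrite !inE in uA vA; have := const u' v' uS' vS' uv (phi v').
by rewrite inE mem_rcons inE eqxx orbT (negbTE vA) uA => /(_ isT).
Qed.

End SubdividedLines.

(** Every vertex descends to [r]; of [x] and [y], the one separated from [r] by [A] meets a crossing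
    edge on the way. *)
Lemma connected_rooted (V : finType) (e : rel V) (S : {set V}) (l : V -> nat) r :
  symmetric e -> (forall u, u \in S -> u <> r -> exists v, [/\ v \in S, e u v & l v < l u]) ->
  connected_set e S.
Proof.
move=> e_sym desc.
have to_root (A : {set V}) x : x \in S -> (x \in A) != (r \in A) ->
    exists u v, [/\ u \in S, v \in S, u \in A, v \notin A & e u v].
  have [m] := ubnP (l x); elim: m x => // m IH x xm xS xr.
  have xnr : x <> r by move=> xr'; rewrite xr' eqxx in xr.
  have [y [yS xy lyx]] := desc x xS xnr.
  case: (boolP ((x \in A) == (y \in A))) => [/eqP exy|ne].
    by apply: (IH y) => //; [lia | rewrite -exy].
  move: ne; case: (boolP (x \in A)) => xA; case: (boolP (y \in A)) => yA // _.
    by exists x, y.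
  by exists y, x; split=> //; rewrite e_sym.
move=> A x y xS yS xA yA; case: (boolP (r \in A)) => rA.
  by apply: (to_root A y yS); rewrite rA (negbTE yA).
by apply: (to_root A x xS); rewrite xA (negbTE rA).
Qed.

(** * Rows and columns of the elementary wall *)

Section WallLines.

Variable r : nat.
Let H := elementary_wall r.

Definition vrow (u : wall_vertex r) : nat := (val u).1.
Definition vcol (u : wall_vertex r) : nat := (val u).2.

(** Inner rows and inner pairs of grid columns avoid both missing corners. *)
Definition wall_row (i : 'I_r.-1) : {set H} := [set u : H | vrow u == i.+1].
Definition wall_column (j : 'I_r.-1) : {set H} :=
  [set u : H | (vcol u)./2 == j.+1].

Lemma vrow_lt u : vrow u < r.+1.
Proof. exact: ltn_ord. Qed.

Lemma vcol_lt u : vcol u < 2 * r + 2.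
Proof. exact: ltn_ord. Qed.

Lemma wall_vertex_at i c : i < r.+1 -> 0 < c < 2 * r + 1 \/ 0 < i < r ->
  c < 2 * r + 2 -> exists v : H, vrow v = i /\ vcol v = c.
Proof.
move=> ir h cr; pose x : grid r := (Ordinal ir, Ordinal cr).
have xc : ~~ is_corner x by rewrite /is_corner /wrow /wcol /=; lia.
by exists (Sub x xc : H); rewrite /vrow /vcol SubK.
Qed.

Lemma wall_vertex_inj (u v : H) : vrow u = vrow v -> vcol u = vcol v -> u = v.
Proof.
rewrite /vrow /vcol => e1 e2; apply: val_inj; case: (val u) (val v) e1 e2 => a b [c d] /= e1 e2.
by congr pair; apply: val_inj.
Qed.

Lemma wall_row_connected i : connected_set (adj H) (wall_row i).
Proof.
have ir := ltn_ord i.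
have [||| x [x1 x2]] := @wall_vertex_at i.+1 0; try lia.
apply: (@connected_rooted _ _ _ vcol x (@adj_sym H)).
move=> u; rewrite inE => /eqP u1 ux.
have u2 : 0 < vcol u.
  by rewrite lt0n; apply/negP => /eqP z; apply/ux/wall_vertex_inj; rewrite ?u1 ?x1 ?z ?x2.
have ub := vcol_lt u.
have [||| v [v1 v2]] := @wall_vertex_at i.+1 (vcol u).-1; try lia.
exists v; rewrite inE v1 eqxx; split=> //; last by rewrite v2; lia.
by rewrite /= /wall_adj /wrow /wcol -!/(vrow _) -!/(vcol _) /consec v1 v2 u1; lia.
Qed.

Lemma wall_column_connected j : connected_set (adj H) (wall_column j).
Proof.
have jr := ltn_ord j.
have [||| x [x1 x2]] := @wall_vertex_at 0 (2 * j.+1 + 1); try lia.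
(* The zigzag path through the two columns, numbered from the top. *)
pose l (u : H) := 2 * vrow u + (odd (vcol u) == odd (vrow u)).
apply: (@connected_rooted _ _ _ l x (@adj_sym H)).
move=> u; rewrite inE => /eqP u2 ux.
have ub := vrow_lt u.
case: (boolP (odd (vcol u) == odd (vrow u))) => [/eqP par|par].
  have [||| v [v1 v2]] := @wall_vertex_at (vrow u) (2 * j.+1 + ~~ odd (vcol u));
    try lia.
  exists v; rewrite inE v2 /l v1 v2; split; try lia.
  by rewrite /= /wall_adj /wrow /wcol -!/(vrow _) -!/(vcol _) /consec v1 v2; lia.
(* The rung above [u] is kept exactly when its row and column have different parities. *)
have u1 : 0 < vrow u.
  rewrite lt0n; apply/negP => /eqP z; apply/ux/wall_vertex_inj; first by rewrite x1.
  by rewrite x2; move: par; rewrite z; lia.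
have [||| v [v1 v2]] := @wall_vertex_at (vrow u).-1 (vcol u); try lia.
exists v; rewrite inE v2 /l v1 v2; split; try lia.
by rewrite /= /wall_adj /wrow /wcol -!/(vrow _) -!/(vcol _) /consec /rung_removed v1 v2; lia.
Qed.

End WallLines.

Lemma wall_lines r (G : graph) : contains_wall r G ->
  exists F1 F2 : 'I_r.-1 -> {set G},
    [/\ disjoint_family F1, forall j, connected_set (adj G) (F1 j),
        disjoint_family F2, forall j, connected_set (adj G) (F2 j)
      & forall i j, exists2 x, x \in F1 i & x \in F2 j].
Proof.
case=> W [phi [P [phi_inj P1 P2 _ adjW]]] [f [f_inj f_adj]].
have P_inner u v w : adj (elementary_wall r) u v -> phi w \notin P u v.
  by move=> /P1[].
have f_path u v z w : adj (elementary_wall r) u v ->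
    infix [:: z; w] (phi u :: rcons (P u v) (phi v)) -> adj G (f z) (f w).
  by move=> uv i; apply/f_adj/adjW; exists u, v.
pose F S := subdivided_set phi P f S.
exists (fun i => F (wall_row i)), (fun j => F (wall_column j)); split.
- move=> i j x xi xj; have [u] := subdivided_disjoint phi_inj f_inj P_inner P2 xi xj.
  by rewrite !inE => /eqP-> /eqP[] e; apply: val_inj.
- by move=> j; apply: (subdivided_connected f_path); apply: wall_row_connected.
- move=> i j x xi xj; have [u] := subdivided_disjoint phi_inj f_inj P_inner P2 xi xj.
  by rewrite !inE => /eqP-> /eqP[] e; apply: val_inj.
- by move=> j; apply: (subdivided_connected f_path); apply: wall_column_connected.
move=> i j; have ir := ltn_ord i; have jr := ltn_ord j.
have [||| v [v1 v2]] := @wall_vertex_at r i.+1 (2 * j.+1); try lia.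
exists (f (phi v)); apply/subdivided_setP; left; exists v => //; rewrite inE.
  by rewrite v1.
by rewrite v2 mul2n doubleK.
Qed.

Lemma red_lt n (f : 'I_n -> nat) (i j : 'I_n) :
  injective f -> (red f i < red f j) = (f i < f j).
Proof.
move=> f_inj.
have lt_red (s t : 'I_n) : f s < f t -> red f s < red f t.
  move=> st; apply: proper_card; apply/properP; split.
    by apply/subsetP => u; rewrite !inE => /ltn_trans; apply.
  by exists s; rewrite !inE ?ltnn.
by case: (ltngtP (f i) (f j)) => [/lt_red->//|/lt_red|/f_inj->]; rewrite ?ltnn //; lia.
Qed.

(** * From walls to tracks *)

Section Assembly.

Variables (n : nat) (p : 'S_n).
Hypothesis p321 : avoids321 p.

Let X (u : 'I_n) : nat := (p^-1)%g u.
Let Y (u : 'I_n) : nat := u.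

Let X_inj : injective X.
Proof. by move=> u v /val_inj/perm_inj. Qed.

Let Y_inj : injective Y.
Proof. exact: val_inj. Qed.

Lemma avoids321_no321 u v w : X u < X v -> X v < X w -> Y v < Y u -> Y v <= Y w.
Proof.
move=> Xuv Xvw Yvu; rewrite leqNgt; apply/negP => Ywv; apply: p321.
exists (fun i : 'I_3 => (p^-1)%g (if val i == 0 then u else if val i == 1 then v else w)).
rewrite /X /Y in Xuv Xvw Yvu Ywv.
split=> -[[|[|[|//]]] ?] [[|[|[|//]]] ?] //=; first by move=> _; exact: ltn_trans Xuv Xvw.
all: by rewrite !permKV /perm321 !permE /= ?ltnn //; lia.
Qed.

Let col := stair Y_inj avoids321_no321.

Let colX u v : X u < X v -> (col u)./2 <= (col v)./2.
Proof. exact: stairX. Qed.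

Let colY u v : Y u < Y v -> uphalf (col u) <= uphalf (col v).
Proof. exact: stairY. Qed.

Let col_incr u v : col u = col v -> X u < X v -> Y u < Y v.
Proof. exact: stair_incr. Qed.

Lemma threads_contains_track a k : 0 < k -> ~~ odd a ->
  (forall c T, in_window a k c -> T < 3 * k ->
     exists2 u, u \in climb X Y col a k T & col u = c) ->
  contains p (track k).
Proof.
move=> k0 ea full.
have [x [x_col x_right x_left]] := climb_threads X_inj col_incr k0 full.
pose F (t : 'I_(k ^ 2)) := x (track_col k t) (track_lev k t).
exists (fun t => (p^-1)%g (F t)); split=> s t.
  move=> st; apply: (threads_lexX X_inj colX col_incr ea x_col x_right x_left);
    have [sc si sE _] := track_coordP s; have [tc ti tE _] := track_coordP t => //.
  by apply: (@track_position_lex k) => //; rewrite -sE -tE.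
rewrite !permKV /track /reduction !permE red_lt; last exact: track_entry_inj.
have mono s' t' : track_entry s' < track_entry t' -> F s' < F t'.
  move=> st; apply: (threads_lexY X_inj Y_inj colY col_incr ea x_col x_right x_left);
    have [sc si _ sE] := track_coordP s'; have [tc ti _ tE] := track_coordP t' => //.
  by apply: (@track_entry_lex k) => //; rewrite -sE -tE.
case: (ltngtP (track_entry s) (track_entry t)) => [/mono->//|/mono|/track_entry_inj->].
  by lia.
by rewrite ltnn.
Qed.

(** Either every column keeps an unreached vertex at all times below [3 * k], which gives a track,
    or [window_cut] applies with some [T < 3 * k]. *)
Lemma no_track_separates k j : 0 < k -> ~ contains p (track k) ->
  exists A N, separates X Y col (2 * k * j) k (5 * k + 2) A N.
Proof.
move=> k0 nt; set a := 2 * k * j; have ea : ~~ odd a by rewrite /a; lia.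
case: (boolP [forall c : 'I_(a + k), [forall T : 'I_(3 * k), in_window a k c ==>
    [exists u in climb X Y col a k T, col u == c]]]) => [/forallP full|].
  case: nt; apply: (threads_contains_track k0 ea) => c T wc Tk.
  have ck : c < a + k by case/andP: wc.
  have /forallP/(_ (Ordinal Tk)) := full (Ordinal ck); rewrite /= wc /=.
  by case/existsP=> u /andP[uT /eqP cu]; exists u.
case/forallPn=> c /forallPn[T]; rewrite negb_imply => /andP[wc /existsPn none].
have [u cu|A [N [cN lo hi th]]] :=
    @window_cut _ _ _ _ X_inj Y_inj colX colY col_incr a k T c k0 ea wc.
  by have := none u; rewrite cu eqxx andbT.
exists A, N; split=> //; apply: leq_trans cN _.
by have := ltn_ord T; lia.
Qed.

Lemma wall_contains_track k : contains_wall (16 * k + 8) (perm_graph p) ->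
  contains p (track k).
Proof.
move=> /wall_lines[F1 [F2 [d1 c1 d2 c2 F12]]].
case: (posnP k) => [->|k0].
  have no (i : 'I_(0 ^ 2)) : False by case: i.
  by exists (fun i => False_rect _ (no i)); split=> i; case: (no i).
apply: contrapT => nt; pose P := contains_line F1 F2.
have r0 : 0 < (16 * k + 8).-1 by lia.
have [|||A [B [N [v [PA PB BA thB cN]]]]] :=
    @sweep _ X Y col X_inj Y_inj colX colY col_incr P k (5 * k + 2) _ k0.
- by move=> j; apply: no_track_separates.
- rewrite negb_or; apply/andP; split; apply/existsPn => i; apply/subsetPn;
    by have [x x1 x2] := F12 i i; exists x; rewrite ?inE.
- by apply/orP; left; apply/existsP; exists (Ordinal r0); apply: subsetT.
(* The sweep gives a cover of size at most [2 * (5 * k + 2) + 6 * k = 16 * k + 4], whereas the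
   [16 * k + 7] lines in each direction require at least [16 * k + 6]. *)
have := leq_trans (grid_boundary d1 c1 d2 c2 F12 PA PB BA thB) (cN : _ < _.+1).
by clear; lia.
Qed.
End Assembly.

(* The asymptotic bound *)
From mathcomp Require Import all_order all_algebra.
From mathcomp Require Import all_classical all_reals all_analysis.
Import Order.TTheory GRing.Theory Num.Theory.
Import numFieldNormedType.Exports.
Local Open Scope classical_set_scope.
Local Open Scope nat_scope.

Theorem theorem8 (R : realType) :
  exists g : nat -> nat,
    [/\ ((fun k : nat => (g k)%:R : R^o) =O_\oo
           (fun k : nat => (k%:R `^ (3 / 2) : R^o)))%R,
        forall k : nat, ~~ odd (g k) /\ 2 <= g k
      & forall (k n : nat) (p : 'S_n),
          avoids321 p -> contains_wall (g k) (perm_graph p) ->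
          contains p (track k)].
Proof.
exists (fun k => 16 * k + 8); split.
- apply/eqOP; near=> C; near=> k.
  have k1 : (1 <= k%:R :> R)%R by rewrite ler1n; near: k; exact: nbhs_infty_ge.
  rewrite ger0_norm ?ler0n // ger0_norm ?powR_ge0 //.
  have -> : ((16 * k + 8)%N%:R = 16 * k%:R + 8 :> R)%R by rewrite natrD natrM.
  (* For [k >= 1], [16 * k + 8 <= 24 * k], and [k] is at most its power with exponent [3 / 2]. *)
  have C24 : (24 <= C)%R by near: C; apply: nbhs_pinfty_ge.
  apply: (@le_trans _ _ (24 * k%:R)%R).
    have -> : (24 * k%:R = 16 * k%:R + 8 * k%:R :> R)%R by rewrite -mulrDl -natrD.
    by rewrite lerD2l ler_peMr.
  apply: ler_pM => //.
  rewrite -[leLHS]powRr1 ?ler0n //; apply: ler_powR => //.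
  by rewrite ler_pdivlMr // mul1r ler_nat.
- by move=> k; rewrite oddD oddM; split=> //; rewrite addnC.
- by move=> k n p p321; apply: (wall_contains_track p321).
Unshelve. all: by end_near.
Qed.
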